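(* Let $n, k \geq 1$ be integers. Let $\pi = (\pi_1, \pi_2, \ldots, \pi_n) \in \mathfrak{S}_n$ and let $i^* = \pi^{-1}(n)$ be the index with $\pi_{i^*}=n$. Then $$|\mathcal{O}^{-1}_{\mathrm{CPF}_n(k)}(\pi)| = \sum_{i = i^*}^n |\mathcal{O}^{-1}_{\mathrm{CPF}_{i-1}(k)}(\alpha(\pi, k, i^*, i))| \cdot |\mathcal{O}^{-1}_{\mathrm{CPF}_{n - i}(k)}(\beta(\pi, k, i^*, i))|$$ where $$\alpha(\pi, k, i^*, i) = \begin{cases} \mathrm{pattern}(\pi_{1 : i^* - 1} ; \pi_{i^* + 1:i}), & \text{if } i \leq i^* + k, \\ \mathrm{pattern}(\pi_{1 : i^* - 1} ; \pi_{i^* + 1:i^* + k - 1} ; \pi_i ; \pi_{i^* + k: i - 1}), & \text{if } i > i^* + k, \end{cases}$$ and $\beta(\pi, k, i^*, i) = \mathrm{pattern}(\pi_{i + 1:n})$.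
   Context: There are $n$ cars, numbered $1,\dots,n$, entering in this order a one-way street with parking spots $1,2,\dots,n$ (in this order along the street). A preference tuple is $\alpha=(a_1,\dots,a_n)\in[n]^n$, where $[n]=\{1,\dots,n\}$ and $a_i$ is the preferred spot of car $i$. $k$-cascading parking rule ($k\ge 0$ an integer): when car $i$ enters, if spot $a_i$ is available it parks there. If spot $a_i$ is occupied and $k\geq 1$, car $i$ parks in spot $a_i$ and bumps the car occupying it out of it; the bumped car attempts to park in the spot immediately after the one it was bumped from: if that spot is available it parks there; if it is occupied and fewer than $k$ bumps have occurred since the arrival of car $i$, it parks there and bumps the car occupying it, which then attempts to park in the next spot in the same way, and so on. Once $k$ bumps have occurred, the last displaced car continues down the street without bumping any more cars and parks in the first unoccupied spot it encounters, if any. A car that runs past spot $n$ fails to park. For $k=0$ no bumping occurs and a car finding its preferred spot occupied continues forward to the first available spot. $\alpha$ is a $k$-cascading parking function if all cars can park under this rule; $\mathrm{CPF}_n(k)$ is the set of $k$-cascading parking functions of length $n$. The outcome of $\alpha\in\mathrm{CPF}_n(k)$ is the permutation $\pi=(\pi_1,\dots,\pi_n)\in\mathfrak{S}_n$ (permutations of $[n]$, one-line notation) such that $\pi_i=j$ means that car $j$ is parked in spot $i$ at the end of the process. $\mathcal{O}^{-1}_{\mathrm{CPF}_n(k)}(\pi)$ denotes the set of $\alpha\in\mathrm{CPF}_n(k)$ whose outcome (under the $k$-cascading rule) is $\pi$. For length $0$, the fiber of the empty permutation has size $1$. For a word $w$ with distinct entries in the positive integers, $\mathrm{pattern}(w)$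 is the permutation of $\{1,\dots,|w|\}$ (as a word in one-line notation) with entries in the same relative order as those of $w$, e.g. $\mathrm{pattern}(32517)=(3,2,4,1,5)$. For words $w_1,w_2$ with no shared or repeated entries, $w_1;w_2$ is their concatenation. For indices $i,j$, $w_{i:j}$ is the word $w_i,\dots,w_j$, and is the empty word if $i>j$. *)

(* Defs.v *)
From mathcomp Require Import all_boot all_fingroup.
Set Implicit Arguments.
Unset Strict Implicit.
Unset Printing Implicit Defensive.

(* A street is the sequence of contents of its spots: entry p (counted from 1)
   is [Some c] if car c is parked in spot p, and [None] if spot p is free. *)
Definition street := seq (option nat).

(* [drive k c s]: car c attempts to park in the first spot of the stretch s,
   which runs to the end of the street, when k more bumps are allowed.
   If that spot is taken by d and k > 0, then c parks there and the bumped d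
   attempts the next spot; if k = 0, then c moves on to the next spot.
   The result is [None] if some car runs past the end of the street. *)
Fixpoint drive (k c : nat) (s : street) : option street :=
  match s with
  | [::] => None
  | None :: s' => Some (Some c :: s')
  | Some d :: s' =>
      if k is k'.+1 then omap (cons (Some c)) (drive k' d s')
      else omap (cons (Some d)) (drive 0 c s')
  end.

(* a is the preferred spot of car c, counted from 1. *)
Definition arrive (k c a : nat) (s : street) : option street :=
  omap (cat (take a.-1 s)) (drive k c (drop a.-1 s)).

(* The cars 1, ..., [size a] enter in this order; [None] if some car fails to
   park. *)
Definition park (n k : nat) (a : seq nat) : option street :=
  foldl (fun os ca => obind (arrive k ca.1 ca.2) os)
        (Some (nseq n None)) (zip (iota 1 (size a)) a).

(* In a preference tuple, j : 'I_n stands for spot j + 1. *)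
Definition final_street (n k : nat) (a : n.-tuple 'I_n) : option street :=
  park n k [seq (val j).+1 | j <- a].

Definition CPF (n k : nat) : {set n.-tuple 'I_n} :=
  [set a | isSome (final_street k a)].

(* The fiber of a permutation of {1, ..., n}, given as the word w of its
   one-line notation. *)
Definition fiber (n k : nat) (w : seq nat) : {set n.-tuple 'I_n} :=
  [set a in CPF n k | final_street k a == Some [seq Some c | c <- w]].

Definition oneline (n : nat) (pi : 'S_n) : seq nat :=
  [seq (val (pi j)).+1 | j <- enum 'I_n].

(* For a word with distinct entries, the number of entries <= x is the rank
   of x. *)
Definition pattern (w : seq nat) : seq nat :=
  [seq count (fun y => y <= x) w | x <- w].

(* The word w_i, ..., w_j, with positions counted from 1; empty if i > j. *)
Definition subword (w : seq nat) (i j : nat) : seq nat := drop i.-1 (take j w).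

Definition alpha_word (w : seq nat) (k istar i : nat) : seq nat :=
  if i <= istar + k then
    pattern (subword w 1 (istar - 1) ++ subword w (istar + 1) i)
  else
    pattern (subword w 1 (istar - 1)
             ++ subword w (istar + 1) (istar + k - 1)
             ++ subword w i i
             ++ subword w (istar + k) (i - 1)).

Definition beta_word (w : seq nat) (i : nat) : seq nat :=
  pattern (subword w (i + 1) (size w)).

(* Main.v *)
Require Import Defs.
From mathcomp Require Import all_boot all_fingroup.
From mathcomp Require Import zify.

Set Implicit Arguments.
Unset Strict Implicit.
Unset Printing Implicit Defensive.

(** The recursion comes from removing the last car.  Since k >= 1, car n
    always parks in its preferred spot, so that spot is i*.  Just before it
    arrives exactly one spot i is free, and i >= i*.  The arrival of n pushes
    the cars of spots i*, ..., i - 1 along until spot i is filled: the first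
    of them move by one spot each, and if the bumps run out, the last bumped
    car jumps over the others to spot i.  This displacement ([cascade]) is
    injective, so pi and i determine the street before the last arrival: its
    left part is the word behind [alpha_word], its right part the suffix of
    pi after i ([prior_streetE], [step_last]).

    It remains to count the preferences of the cars 1, ..., n - 1 that lead to
    a street T1, hole, T2 ([ways_split]).  A car that reached the hole would
    occupy it for good, hence no car ever crosses it.  Thus the cars found in
    T1 at the end prefer spots of T1 and interact only with one another, and
    likewise for T2; the two processes are independent and the counts
    multiply.  Finally, the rule never compares the labels of cars: only their
    order of arrival matters, so each factor is the size of the fiber of the
    standardized word ([card_fiber_pattern]).

    Preference sequences are counted through a transfer operator: [step] sums
    a function over the possible results of one arrival, and [total] iterates
    it over a list of cars.  This operator is peeled at the front in the
    inductions over the cars, and at the back to isolate the last car. *)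

(** * The effect of one arrival *)

(** The contents of a run of spots x followed by a free spot, after c has
    entered at its first spot with k bumps allowed; the former free spot is
    included. *)
Fixpoint cascade (k c : nat) (x : seq nat) : seq nat :=
  match x with
  | [::] => [:: c]
  | d :: x' => if k is k'.+1 then c :: cascade k' d x' else d :: cascade 0 c x'
  end.

Lemma size_cascade k c x : size (cascade k c x) = (size x).+1.
Proof. by elim: x k c => [|d x IH] [|k] c //=; rewrite IH. Qed.

Lemma perm_cascade k c x : perm_eq (cascade k c x) (c :: x).
Proof.
elim: x k c => [|d x IH] [|k] c //=; last by rewrite perm_cons IH.
by rewrite -[X in perm_eq _ X]/([:: c] ++ [:: d] ++ x) perm_sym perm_catCA perm_cons perm_sym IH.
Qed.

Lemma cascade0 c x : cascade 0 c x = rcons x c.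
Proof. by elim: x => //= d x ->. Qed.

(** The result has one more car than x, so its length gives that of x; then
    each bump reveals the bumping car at the head and leaves a cascade.  The
    car c must be allowed to vary for the induction, as the bumped car takes
    its place. *)
Lemma cascade_inj k c e x y :
  cascade k c x = cascade k e y -> c = e /\ x = y.
Proof.
elim: x k c e y => [|d x IH] [|k] c e [|f y] //=.
- by case.
- by case=> _; rewrite cascade0; case: y.
- by case.
- by case=> _ /(congr1 size); rewrite size_cascade.
- by case=> _; rewrite cascade0; case: x {IH}.
- by case=> -> /IH[-> ->].
- by case=> _ /(congr1 size); rewrite size_cascade.
- by case=> -> /IH[-> ->].
Qed.

Lemma cascade_short k c x : size x <= k -> cascade k c x = c :: x.
Proof. by elim: x k c => [|d x IH] [|k] c //= /IH->. Qed.

(** Here k = |p| + 1: the cars of p use up all bumps but the first, so d is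
    displaced by the k-th one and has to drive past q. *)
Lemma cascade_long c p d q :
  cascade (size p).+1 c (p ++ d :: q) = c :: p ++ rcons q d.
Proof. by elim: p c => [|e p IH] c /=; [rewrite cascade0 | rewrite -IH]. Qed.

Lemma drive_full k c x : drive k c (map Some x) = None.
Proof. by elim: x k c => [|d x IH] [|k] c //=; rewrite IH. Qed.

Lemma drive_hole k c x r :
  drive k c (map Some x ++ None :: r) = Some (map Some (cascade k c x) ++ r).
Proof. by elim: x k c => [|d x IH] [|k] c //=; rewrite IH. Qed.

Variant first_hole_spec : street -> Type :=
  | NoHole x : first_hole_spec (map Some x)
  | Hole x r : first_hole_spec (map Some x ++ None :: r).

Lemma first_holeP s : first_hole_spec s.
Proof.
elim: s => [|[d|] s IH]; first exact: (NoHole [::]); last exact: (Hole [::] s).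
by case: IH => [x | x r]; [apply: (NoHole (d :: x)) | apply: (Hole (d :: x) r)].
Qed.

Lemma drive_cat k c s1 s2 t :
  drive k c s1 = Some t -> drive k c (s1 ++ s2) = Some (t ++ s2).
Proof.
case: (first_holeP s1) => [x | x r]; first by rewrite drive_full.
by rewrite -catA /= !drive_hole => -[<-]; rewrite catA.
Qed.

Lemma arriveP k c a s t : arrive k c a.+1 s = Some t ->
  exists p x r, [/\ size p = a, s = p ++ map Some x ++ None :: r
                  & t = p ++ map Some (cascade k c x) ++ r].
Proof.
rewrite /arrive /=; have [lt_as|le_sa] := ltnP a (size s); last by rewrite drop_oversize.
case E: {-}_ / (first_holeP (drop a s)) => [x | x r].
  by rewrite E drive_full.
rewrite E drive_hole => -[<-]; exists (take a s), x, r; split=> //.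
  by rewrite size_takel // ltnW.
by rewrite -E cat_take_drop.
Qed.

Lemma arrive_mem k c a s t : arrive k c a.+1 s = Some t -> Some c \in t.
Proof.
case/arriveP=> p [x [r [_ _ ->]]]; rewrite !mem_cat mem_map; last by move=> ? ? [].
by rewrite (perm_mem (perm_cascade k c x)) mem_head orbT.
Qed.

Lemma arrive_keep k c a s t d :
  arrive k c a.+1 s = Some t -> Some d \in s -> Some d \in t.
Proof.
case/arriveP=> p [x [r [_ -> ->]]].
have injS : injective (@Some nat) by move=> ? ? [].
rewrite !mem_cat inE /= !(mem_map injS) (perm_mem (perm_cascade k c x)) inE.
by case/or3P=> ->; rewrite ?orbT.
Qed.

Lemma size_arrive k c a s t : arrive k c a.+1 s = Some t -> size t = size s.
Proof.
case/arriveP=> p [x [r [_ -> ->]]].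
by rewrite !size_cat /= !size_map size_cascade addSnnS.
Qed.

(** Bumping replaces the car in a spot but never frees it. *)
Lemma arrive_occupied k c a s t i :
  arrive k c a.+1 s = Some t -> nth None s i -> nth None t i.
Proof.
case/arriveP=> p [x [r [_ -> ->]]].
rewrite !nth_cat !size_map size_cascade; case: ltnP => // _.
case: ltnP => [lt_i _ | le_i].
  by rewrite leqW // (nth_map 0) // size_cascade leqW.
rewrite ltnS; case: ltngtP le_i => // [lt_i|<-] _; last by rewrite subnn.
by rewrite -(subnSK lt_i).
Qed.

(** * Summing over preference sequences *)

Definition step k c (F : street -> nat) (s : street) : nat :=
  \sum_(0 <= a < size s) oapp F 0 (arrive k c a.+1 s).

Definition total k (cs : seq nat) (F : street -> nat) : street -> nat :=
  foldr (step k) F cs.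

Definition ways k cs (T s : street) : nat := total k cs (fun t => t == T) s.

Lemma total_rcons k cs c F :
  total k (rcons cs c) F = total k cs (step k c F).
Proof. exact: foldr_rcons. Qed.

Lemma eq_step k c F G : F =1 G -> step k c F =1 step k c G.
Proof.
by move=> eFG s; apply: eq_bigr => a _; case: arrive => //= t; rewrite eFG.
Qed.

Lemma eq_total k cs F G : F =1 G -> total k cs F =1 total k cs G.
Proof. by move=> eFG; elim: cs => //= c cs IH; apply: eq_step. Qed.

Lemma total_sum k cs (I : Type) (r : seq I) (F : I -> street -> nat) s :
  total k cs (fun t => \sum_(i <- r) F i t) s = \sum_(i <- r) total k cs (F i) s.
Proof.
elim: cs s => //= c cs IH s; rewrite /step exchange_big /=; apply: eq_bigr => a _.
by case: arrive => [t|] /=; [exact: IH | rewrite big1].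
Qed.

(** No step of the rule inspects a label, so renaming commutes with it. *)
Lemma total_relabel (f : nat -> nat) k cs F s :
  total k (map f cs) F (map (omap f) s)
    = total k cs (fun t => F (map (omap f) t)) s.
Proof.
have casc q c x : cascade q (f c) (map f x) = map f (cascade q c x).
  by elim: x q c => [|d x IH] [|q] c //=; rewrite IH.
have driv c u : drive k (f c) (map (omap f) u) = omap (map (omap f)) (drive k c u).
  case: (first_holeP u) => [x|x r].
    by rewrite drive_full -map_comp (map_comp Some f) drive_full.
  rewrite map_cat /= -map_comp (map_comp Some f) !drive_hole casc /=.
  by rewrite map_cat -!map_comp.
elim: cs s => //= c cs IH s; rewrite /step size_map; apply: eq_bigr => a _.
rewrite /arrive /= -map_drop -map_take driv.
by case: drive => //= t; rewrite -map_cat IH.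
Qed.

Lemma ways_relabel (f : nat -> nat) k cs T s : injective f ->
  ways k (map f cs) (map (omap f) T) (map (omap f) s) = ways k cs T s.
Proof.
move=> inj_f; rewrite /ways total_relabel; apply: eq_total => t.
by rewrite (inj_eq (inj_map (inj_omap inj_f))).
Qed.

(** * Independence of the two sides of a hole *)

Lemma step_gt0 k c F s : 0 < step k c F s ->
  exists a t, arrive k c a.+1 s = Some t /\ 0 < F t.
Proof.
rewrite /step lt0n sum_nat_seq_neq0 => /hasP[a _ /=].
by case E: arrive => [t|] //=; rewrite -lt0n; exists a, t.
Qed.

Lemma ways_occupied k cs T s i :
  nth None s i -> ~~ nth None T i -> ways k cs T s = 0.
Proof.
move=> si Ti; apply/eqP; rewrite -leqn0 leqNgt.
apply/negP; elim: cs s si => [|c cs IH] s si.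
  by rewrite /ways /= lt0b => /eqP es; rewrite -es si in Ti.
by case/step_gt0=> a [t [/arrive_occupied/(_ si)/IH]].
Qed.

Lemma arrive_cat k c p s :
  arrive k c (size p).+1 (p ++ s) = omap (cat p) (drive k c s).
Proof. by rewrite /arrive take_size_cat ?drop_size_cat. Qed.

Lemma arrive_left k c a s1 s2 t :
  arrive k c a.+1 s1 = Some t -> arrive k c a.+1 (s1 ++ s2) = Some (t ++ s2).
Proof.
case/arriveP=> p [x [r [<- -> ->]]].
by rewrite -!catA arrive_cat /= drive_hole.
Qed.

Lemma arrive_right k c a s1 s2 :
  arrive k c (size s1 + a).+1 (s1 ++ s2) = omap (cat s1) (arrive k c a.+1 s2).
Proof.
rewrite /arrive /= take_cat drop_cat ltnNge leq_addr addKn /=.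
by case: drive => //= t; rewrite catA.
Qed.

(** A car starting in s1, or at the hole itself, that does not find a spot in
    s1 runs on to the hole: failing in s1 means that no spot of s1 is free from
    the preferred one on. *)
Lemma arrive_fills_hole k c a s1 s2 : a <= size s1 ->
    arrive k c a.+1 s1 = None ->
  exists2 t, arrive k c a.+1 (s1 ++ None :: s2) = Some t & nth None t (size s1).
Proof.
move=> le_a; have ea : size (take a s1) = a by rewrite size_takel.
rewrite -(cat_take_drop a s1) -[in a.+1]ea arrive_cat -catA arrive_cat.
case: (first_holeP (drop a s1)) => [x|x r]; last by rewrite drive_hole.
rewrite drive_hole /= => _; eexists; first by [].
rewrite size_cat size_map nth_cat ltnNge leq_addr addKn /= nth_cat.
by rewrite size_map size_cascade ltnSn (nth_map 0) // size_cascade.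
Qed.

(** When F vanishes on streets whose hole has been filled, only the arrivals
    contained in one of the two sides contribute. *)
Lemma step_split k c F s1 s2 :
    (forall t, nth None t (size s1) -> F t = 0) ->
  step k c F (s1 ++ None :: s2)
    = step k c (fun t => F (t ++ None :: s2)) s1
      + step k c (fun t => F (s1 ++ None :: t)) s2.
Proof.
move=> F0; have into_hole a : a <= size s1 -> arrive k c a.+1 s1 = None ->
    oapp F 0 (arrive k c a.+1 (s1 ++ None :: s2)) = 0.
  by move=> le_a /(arrive_fills_hole s2 le_a)[t -> /F0].
rewrite /step size_cat (big_cat_nat _ (n := size s1)) ?leq_addr //=.
congr (_ + _).
  rewrite !big_nat; apply: eq_bigr => a /= lt_a.
  case E: (arrive k c a.+1 s1) => [t|]; first by rewrite (arrive_left _ E).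
  by rewrite into_hole // ltnW.
rewrite -{1}[size s1]add0n big_addn addKn big_nat_recl // add0n into_hole //; last first.
  by rewrite /arrive /= drop_size.
rewrite add0n; apply: eq_bigr => a _.
rewrite addnC arrive_right -[None :: s2]cat1s (arrive_right _ _ _ [:: None]).
by case: arrive.
Qed.

Lemma ways_hole_step k c cs T1 T2 s1 s2 : size s1 = size T1 ->
  let T := T1 ++ None :: T2 in
  ways k (c :: cs) T (s1 ++ None :: s2)
    = step k c (fun t => ways k cs T (t ++ None :: s2)) s1
      + step k c (fun t => ways k cs T (s1 ++ None :: t)) s2.
Proof.
move=> es T; apply: (@step_split k c (ways k cs T)) => t occ.
apply: (ways_occupied _ _ occ).
by rewrite es nth_cat ltnn subnn.
Qed.

(** As no car crosses a spot that stays free, a car is still on its side of the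
    hole at the end. *)
Lemma ways_mem k cs T1 T2 s1 s2 d : size s1 = size T1 ->
    0 < ways k cs (T1 ++ None :: T2) (s1 ++ None :: s2) ->
  (Some d \in s1 -> Some d \in T1) /\ (Some d \in s2 -> Some d \in T2).
Proof.
elim: cs s1 s2 => [|c cs IH] s1 s2 es.
  by rewrite /ways /= lt0b eqseq_cat // => /andP[/eqP-> /eqP[->]].
rewrite (ways_hole_step _ _ _ _ _ es) addn_gt0.
case/orP=> /step_gt0[a [t [at_t /IH]]].
  rewrite (size_arrive at_t) => /(_ es)[IH1 IH2].
  by split=> // /(arrive_keep at_t).
by case=> // IH1 IH2; split=> // /(arrive_keep at_t).
Qed.

(** For the first car c, the summand of [step_split] on the wrong side is zero:
    c would then end on that side by [ways_mem], against the disjointness of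
    the labels of T1 and T2.  On the other side the induction hypothesis
    factors out the part that c does not touch. *)
Lemma ways_split k cs T1 T2 s1 s2 : size s1 = size T1 ->
    (forall c, Some c \in T1 -> Some c \notin T2) ->
  ways k cs (T1 ++ None :: T2) (s1 ++ None :: s2)
  = ways k [seq c <- cs | Some c \in T1] T1 s1
    * ways k [seq c <- cs | Some c \notin T1] T2 s2.
Proof.
move=> es disj; elim: cs s1 s2 es => [|c cs IH] s1 s2 es.
  by rewrite /ways /= eqseq_cat // eqseq_cons eqxx mulnb.
rewrite (ways_hole_step _ _ _ _ _ es).
pose W1 := ways k [seq d <- cs | Some d \in T1] T1.
pose W2 := ways k [seq d <- cs | Some d \notin T1] T2.
set T := T1 ++ _ in IH *.
have eL : step k c (fun t => ways k cs T (t ++ None :: s2)) s1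
    = (Some c \in T1) * step k c W1 s1 * W2 s2.
  rewrite -mulnA /step big_distrl big_distrr; apply: eq_bigr => a _ /=.
  case E: arrive => [t|] /=; last by rewrite muln0.
  have et : size t = size T1 by rewrite (size_arrive E).
  case: (boolP (Some c \in T1)) => cT; first by rewrite mul1n IH.
  apply/eqP; rewrite -leqn0 leqNgt; apply: contra cT => /(ways_mem c et)[-> //].
  exact: arrive_mem E.
have eR : step k c (fun t => ways k cs T (s1 ++ None :: t)) s2
    = (Some c \notin T1) * W1 s1 * step k c W2 s2.
  rewrite /step big_distrr; apply: eq_bigr => a _ /=.
  case E: arrive => [t|] /=; last by rewrite muln0.
  case: (boolP (Some c \in T1)) => cT; last by rewrite mul1n IH.
  apply/eqP; rewrite -leqn0 leqNgt; apply: contra (disj c cT).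
  case/(ways_mem c es) => _ -> //.
  exact: arrive_mem E.
rewrite eL eR /=; case: (Some c \in T1) => /=.
  by rewrite mul1n !mul0n addn0.
by rewrite mul1n !mul0n.
Qed.

(** * Fibers as numbers of ways *)

Lemma sum_tuple_cons (T : finType) m (F : m.+1.-tuple T -> nat) :
  \sum_(t : m.+1.-tuple T) F t
    = \sum_(x : T) \sum_(u : m.-tuple T) F [tuple of x :: u].
Proof.
rewrite pair_big /= (reindex (fun p : T * m.-tuple T => [tuple of p.1 :: p.2])) //.
exists (fun t => (thead t, behead_tuple t)) => [[x u] _|t _] /=.
  by congr (_, _); apply: val_inj.
by rewrite -tuple_eta.
Qed.

Lemma sum_park n k m j (s T : street) : size s = n ->
  \sum_(a : m.-tuple 'I_n)
      (foldl (fun os ca => obind (arrive k ca.1 ca.2) os) (Some s)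
         (zip (iota j m) [seq (val x).+1 | x <- a]) == Some T)
    = ways k (iota j m) T s.
Proof.
elim: m j s => [|m IH] j s sz /=.
  by rewrite (big_pred1 [tuple]) // => t; rewrite [t]tuple0 [RHS]eqxx.
rewrite sum_tuple_cons /ways /= /step sz big_mkord; apply: eq_bigr => x _ /=.
case E: arrive => [t|] /=; first by rewrite IH // (size_arrive E).
by rewrite big1 // => u _; elim: (zip _ _).
Qed.

Lemma card_fiber n k w :
  #|fiber n k w| = ways k (iota 1 n) (map Some w) (nseq n None).
Proof.
rewrite -(sum_park k n 1 _ (size_nseq n None)) -sum1_card big_mkcond /=.
apply: eq_bigr => a _; rewrite !inE /final_street /park size_map size_tuple.
by case: eqP => [->|_]; rewrite ?andbF.
Qed.

Lemma rank_sorted cs : sorted ltn cs ->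
  [seq count (fun y => y <= x) cs | x <- cs] = iota 1 (size cs).
Proof.
elim: cs => //= c cs IH; rewrite (path_sortedE ltn_trans) => /andP[/allP gtc /IH eqcs].
rewrite leqnn (eq_in_count (a2 := pred0)) ?count_pred0; last first.
  by move=> y /gtc; rewrite ltnNge => /negbTE.
congr (_ :: _); rewrite -[2]/(1 + 1) iotaDl -eqcs -map_comp; apply/eq_in_map => x /gtc/ltnW.
by move=> /= ->.
Qed.

(** Renaming the cars by their rank turns cs, their order of arrival, into
    1, ..., n and w into its pattern. *)
Lemma card_fiber_pattern n k (w cs : seq nat) :
    size w = n -> perm_eq cs w -> sorted ltn cs ->
  #|fiber n k (pattern w)| = ways k cs (map Some w) (nseq n None).
Proof.
move=> <- eqcw lt_cs.
pose rank x := count (fun y => y <= x) w.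
(* The rank is injective on w only; labels outside w are sent beyond all
   ranks to get an injective renaming of all labels. *)
pose f x := if x \in w then rank x else x + (size w).+1.
have lt_rank x y : y \in w -> x < y -> rank x < rank y.
  move=> yw lt_xy; rewrite /rank !(seq.permP (perm_to_rem yw)) /=.
  rewrite leqnn (leqNgt y) lt_xy add0n ltnS.
  by apply: sub_count => z /= /leq_trans; apply; exact: ltnW.
have inj_f : injective f.
  have le_rank x : rank x <= size w by exact: count_size.
  move=> x y; rewrite /f; case: ifP => xw; case: ifP => yw.
  - by case: (ltngtP x y) => // [/(lt_rank _ _ yw)|/(lt_rank _ _ xw)] lt e;
      rewrite e ltnn in lt.
  - by have := le_rank x; lia.
  - by have := le_rank y; lia.
  - by lia.
rewrite card_fiber -[RHS](ways_relabel _ _ _ _ inj_f) map_nseq -map_comp; congr ways.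
  rewrite -(perm_size eqcw) -rank_sorted //; apply/eq_in_map => x.
  by rewrite (perm_mem eqcw) /f /rank => ->; rewrite (seq.permP eqcw).
rewrite /pattern -map_comp; apply/eq_in_map => x xw /=.
by rewrite /f xw.
Qed.

(** * The street before the last arrival *)

(** The word of which [alpha_word] is the pattern. *)
Definition left_word (w : seq nat) (k istar i : nat) : seq nat :=
  if i <= istar + k then
    subword w 1 (istar - 1) ++ subword w (istar + 1) i
  else
    subword w 1 (istar - 1)
    ++ subword w (istar + 1) (istar + k - 1)
    ++ subword w i i
    ++ subword w (istar + k) (i - 1).

Lemma drop_take_cat (T : Type) (w : seq T) a b c : a <= b <= c ->
  drop a (take b w) ++ drop b (take c w) = drop a (take c w).
Proof.
case/andP=> le_ab le_bc; rewrite -(take_takel w le_bc).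
by rewrite -[RHS](cat_take_drop (b - a)) take_drop drop_drop subnK.
Qed.

(** The reason for the two cases of [alpha_word]: in both of them, letting c
    enter at its spot in w after the cars of the left word, with spot i free,
    restores w.  The second case is that of [cascade_long], the entry at spot
    i being the car displaced by the last bump. *)
Lemma left_wordP (w : seq nat) k c i : c \in w -> 0 < k -> index c w < i <= size w ->
  exists x, [/\ size (take (index c w) w ++ x) = i.-1,
    left_word w k (index c w).+1 i = take (index c w) w ++ x
    & w = take (index c w) w ++ cascade k c x ++ drop i w].
Proof.
move=> cw k_gt0; set j := index c w => /andP[lt_ji le_i].
have wE : w = take j w ++ (c :: drop j.+1 (take i w)) ++ drop i w.
  rewrite -{1}(cat_take_drop i w); rewrite catA; congr (_ ++ _).
  rewrite -{1}(cat_take_drop j (take i w)) take_takel ?(ltnW lt_ji) //; congr (_ ++ _).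
  by rewrite (drop_nth 0) ?nth_take ?nth_index // size_takel.
have sz_j : size (take j w) = j by rewrite size_takel //; lia.
rewrite /left_word /subword !subn1 !addn1 /= drop0.
case: ifP => [le_ik|/negbT lt_ki].
  exists (drop j.+1 (take i w)); split=> //.
    by rewrite size_cat sz_j size_drop size_takel //; lia.
  by rewrite cascade_short // size_drop size_takel //; lia.
case: k k_gt0 lt_ki => // k _ lt_ki; rewrite addnS /=.
(* The bumped cars p, the car d that jumps to spot i, the cars q jumped over. *)
set p := drop j.+1 _; set q := drop _ (take i.-1 w).
have sz_p : size p = k by rewrite size_drop size_takel; lia.
have [d dE] : exists d, drop i.-1 (take i w) = [:: d].
  have : size (drop i.-1 (take i w)) = 1 by rewrite size_drop size_takel; lia.
  by case: (drop _ _) => [|d []] // _; exists d.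
have pqd : p ++ rcons q d = drop j.+1 (take i w).
  by rewrite -cats1 -dE !drop_take_cat //; lia.
rewrite dE; exists (p ++ d :: q); split=> //.
  have := congr1 size pqd; rewrite size_drop size_takel // !size_cat size_rcons /= sz_j.
  by lia.
by rewrite -sz_p cascade_long pqd.
Qed.

Lemma map_Some_cat3 w p y r : p ++ map Some y ++ r = map (@Some nat) w ->
  exists p' r', [/\ p = map Some p', r = map Some r' & w = p' ++ y ++ r'].
Proof.
move=> e; have injS : injective (@Some nat) by move=> ? ? [].
have pE : p = map Some (take (size p) w) by rewrite map_take -e take_size_cat.
have rE : r = map Some (drop (size p + size y) w).
  by rewrite map_drop -e catA drop_size_cat // size_cat size_map.
exists (take (size p) w), (drop (size p + size y) w); split=> //.
by apply: (inj_map injS); rewrite !map_cat -pE -rE.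
Qed.

(** As k > 0, the cascade starts with c itself, so c ends in the spot that it
    prefers. *)
Lemma arrive_fullP k c a t (w : seq nat) : 0 < k -> uniq w ->
    arrive k c a.+1 t = Some (map Some w) ->
  exists p x r, [/\ size p = a, index c w = a, w = p ++ cascade k c x ++ r
    & t = map Some (p ++ x) ++ None :: map Some r].
Proof.
case: k => // k _ uw /arriveP[p [x [r [sp -> /esym/map_Some_cat3]]]].
case=> p' [r' [pE -> wE]]; exists p', x, r'; rewrite -sp pE size_map.
split=> //; last by rewrite map_cat -catA.
have [y yE] : exists y, cascade k.+1 c x = c :: y.
  by case: (x) => [|d z] /=; [exists [::] | eexists].
move: uw; rewrite wE yE index_cat cat_uniq => /and3P[_ /hasPn/(_ c)].
by rewrite inE eqxx /= => /(_ isT)/negbTE-> _; rewrite eqxx addn0.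
Qed.

Definition prior_street (w : seq nat) (k istar i : nat) : street :=
  map Some (left_word w k istar i) ++ None :: map Some (drop i w).

Lemma index_hole (x : seq nat) (s : street) :
  index None (map Some x ++ None :: s) = size x.
Proof.
by rewrite index_cat size_map /= addn0; case: ifP => // /mapP[y _].
Qed.

(** The street before the last arrival is determined by its hole and the final
    word, by injectivity of the cascade; conversely, [left_wordP] says that
    this street does lead to w. *)
Lemma prior_streetE (w : seq nat) k c i t : 0 < k -> uniq w -> c \in w ->
    index c w < i <= size w ->
  (t == prior_street w k (index c w).+1 i)
  = (i == (index None t).+1)
    && (arrive k c (index c w).+1 t == Some (map Some w)).
Proof.
move=> k_gt0 uw cw lt_i; have [x [sx lE wE]] := left_wordP cw k_gt0 lt_i.
have sz_j : size (take (index c w) w) = index c w.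
  by rewrite size_takel // ltnW // index_mem.
have i_gt0 : 0 < i by lia.
rewrite /prior_street lE; apply/eqP/andP => [->|[/eqP iE /eqP]].
  rewrite index_hole sx prednK // eqxx map_cat -catA; split=> //.
  rewrite -{1}sz_j -[in (size _).+1](size_map Some) arrive_cat drive_hole /=.
  by rewrite {4}wE !map_cat.
case/(arrive_fullP k_gt0 uw) => p [y [r [sp _ wE' tE]]].
rewrite tE; have pE : take (index c w) w = p by rewrite -sp {1}wE' take_size_cat.
have rE : r = drop i w.
  rewrite iE tE index_hole {1}wE' catA drop_size_cat //.
  by rewrite !size_cat size_cascade addnS.
(* Two splittings of w with the same prefix p and the same suffix r: the two
   cascades agree. *)
move: wE; rewrite {1}wE' pE -rE => /(congr1 (drop (size p))).
rewrite !drop_size_cat // => /(congr1 rev); rewrite !rev_cat.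
move/(congr1 (drop (size (rev r)))); rewrite !drop_size_cat // => /(can_inj revK).
by case/cascade_inj=> _ ->.
Qed.

(** Both sides are 0 or 1: only the preference [index c w] can succeed, and
    only the index i of the hole of t can contribute. *)
Lemma step_last k c (w : seq nat) t : 0 < k -> uniq w -> c \in w ->
  step k c (fun u => u == map Some w) t
  = \sum_((index c w).+1 <= i < (size w).+1)
       (t == prior_street w k (index c w).+1 i).
Proof.
move=> k_gt0 uw cw.
set b := arrive k c (index c w).+1 t == Some (map Some w).
have -> : step k c (fun u => u == map Some w) t = b.
  transitivity (\sum_(0 <= a < size t | a == index c w) b).
    rewrite big_mkcond; apply: eq_bigr => a _; rewrite /b.
    case: eqP => [->|ne]; first by case: arrive.
    case E: arrive => [u|] //=; case: eqP => // uE.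
    by rewrite uE in E; case/(arrive_fullP k_gt0 uw): E => p [x [r [_ /esym]]].
  rewrite big_nat1_eq /=; case: ifP => // /negP nlt; rewrite /b.
  case: eqP => // /size_arrive; rewrite size_map => sz.
  by case: nlt; rewrite -sz index_mem.
transitivity (\sum_((index c w).+1 <= i < (size w).+1 | i == (index None t).+1) b).
  rewrite big_nat1_eq; case: ifP => //; rewrite /b; case: eqP => //.
  case/(arrive_fullP k_gt0 uw) => p [x [r [<- _ -> ->]]].
  by rewrite index_hole !ltnS !size_cat size_cascade; lia.
rewrite big_mkcond [LHS]big_nat [RHS]big_nat; apply: eq_bigr => i lt_i.
by rewrite prior_streetE //; case: (i == _).
Qed.

(** * The recursion *)

(** Summing [step_last] over the preferences of the earlier cars leaves, for
    each i, the number of ways to reach a street with a hole at spot i, which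
    [ways_split] factors. *)
Lemma card_fiber_rec m k (w : seq nat) : 0 < k -> perm_eq w (iota 1 m.+1) ->
  #|fiber m.+1 k w| =
    \sum_((index m.+1 w).+1 <= i < m.+2)
      #|fiber (i - 1) k (pattern (left_word w k (index m.+1 w).+1 i))| *
      #|fiber (m.+1 - i) k (pattern (drop i w))|.
Proof.
move=> k_gt0 pw; have uw : uniq w by rewrite (perm_uniq pw) iota_uniq.
have sw : size w = m.+1 by rewrite (perm_size pw) size_iota.
have cw : m.+1 \in w by rewrite (perm_mem pw) mem_iota; lia.
rewrite card_fiber -[X in iota _ X]addn1 iotaD add1n cats1 /ways total_rcons.
rewrite (eq_total _ _ (fun t => step_last t k_gt0 uw cw)) total_sum sw.
rewrite !big_nat; apply: eq_bigr => i /andP[lt_i le_i].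
have [|x [sL LE wE]] := left_wordP cw k_gt0 (i := i); first by lia.
rewrite /prior_street; set L := left_word _ _ _ _ in LE *; set R := drop i w in wE *.
have pLR : perm_eq (L ++ R) (iota 1 m).
  rewrite -(perm_cons m.+1) LE -catA; apply: perm_trans (_ : perm_eq w _).
    rewrite [X in perm_eq _ X]wE -cat1s perm_catCA perm_cat2l catA perm_cat2r.
    by rewrite perm_sym perm_cascade.
  by apply: (perm_trans pw); rewrite -[X in iota _ X]addn1 iotaD add1n cats1 perm_rcons.
have uLR : uniq (L ++ R) by rewrite (perm_uniq pLR) iota_uniq.
have [uL uR disj] : [/\ uniq L, uniq R & forall c, c \in L -> c \notin R].
  move: uLR; rewrite cat_uniq => /and3P[-> /hasPn nR ->]; split=> // c cL.
  by apply/negP => /nR; rewrite /= cL.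
have szL : size L = i - 1 by rewrite LE sL subn1.
have szR : size R = m.+1 - i by rewrite size_drop sw.
have injS : injective (@Some nat) by move=> ? ? [].
have sorted_cars (P : pred nat) : sorted ltn (filter P (iota 1 m)).
  by rewrite sorted_filter ?iota_ltn_sorted //; exact: ltn_trans.
have -> : nseq m.+1 None = nseq (i - 1) None ++ None :: nseq (m.+1 - i) None :> street.
  by rewrite -[None :: _]/(nseq (m.+1 - i).+1 None) -nseqD; congr nseq; lia.
rewrite -/(ways _ _ _ _) ways_split; first last.
- by move=> c; rewrite !mem_map //; exact: disj.
- by rewrite size_nseq size_map.
have inLR c : (c \in iota 1 m) = (c \in L) || (c \in R).
  by rewrite -(perm_mem pLR) mem_cat.
congr (_ * _); apply/esym/card_fiber_pattern => //.
- apply: uniq_perm => //; first by rewrite filter_uniq ?iota_uniq.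
  by move=> c; rewrite mem_filter inLR mem_map //; case: (c \in L).
- apply: uniq_perm => //; first by rewrite filter_uniq ?iota_uniq.
  move=> c; rewrite mem_filter inLR mem_map //.
  by case: (boolP (c \in L)) => // /disj/negbTE->.
Qed.

Theorem theorem2 (n k : nat) (hn : 1 <= n) (hk : 1 <= k) (pi : 'S_n) :
  let w := oneline pi in
  let istar := (index n w).+1 in
  #|fiber n k w| =
    \sum_(istar <= i < n.+1)
      #|fiber (i - 1) k (alpha_word w k istar i)| *
      #|fiber (n - i) k (beta_word w i)|.
Proof.
move=> w istar; case: n hn pi @w @istar => // m _ pi w istar.
have pw : perm_eq w (iota 1 m.+1).
  have uw : uniq w.
    rewrite map_inj_uniq ?enum_uniq // => i j /eqP.
    by rewrite eqSS => /eqP/val_inj/perm_inj.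
  have sub_w : {subset w <= iota 1 m.+1}.
    by move=> _ /mapP[j _ ->]; rewrite mem_iota add1n !ltnS /= -ltnS.
  have [|_ eq_w] := uniq_min_size uw sub_w.
    by rewrite size_iota size_map size_enum_ord.
  by apply: uniq_perm; rewrite ?iota_uniq.
rewrite card_fiber_rec //; apply: eq_bigr => i _.
congr (_ * _); first by rewrite /alpha_word /left_word; case: ifP.
by rewrite /beta_word /subword addn1 take_size.
Qed.
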